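(* For every set $\Gamma\cup\{\phi\}$ of $\mathbf{MD}^+$-formulas: $\Gamma\models\phi$ if and only if $\Gamma\vdash_{\mathbf{MD}^+}\phi$.
   Context: **Language of $\mathbf{MD}^+$ (extended modal dependence logic).** Fix a set $\mathrm{Prop}$ of propositional variables. Classical formulas: $\alpha::=p\mid\bot\mid\neg\alpha\mid\alpha\wedge\alpha\mid\alpha\otimes\alpha\mid\Box\alpha\mid\Diamond\alpha$. Formulas: $\phi::=\alpha\mid\;=\!(\alpha_1,\dots,\alpha_n,\beta)\mid\phi\wedge\phi\mid\phi\otimes\phi\mid\Box\phi\mid\Diamond\phi$, where $n\ge0$ and $\alpha,\alpha_i,\beta$ are classical. Negation applies to classical formulas only. **Team semantics.** A Kripke model is $\mathfrak{M}=(W,R,V)$ with $W\neq\emptyset$, $R\subseteq W\times W$, $V:\mathrm{Prop}\to\wp(W)$. A team is any $X\subseteq W$. $R(X)=\{w\in W\mid\exists v\in X,\ vRw\}$, $R(w)=R(\{w\})$; $XRY$ means $Y\subseteq R(X)$ and $Y\cap R(w)\ne\emptyset$ for every $w\in X$. Satisfaction: - $\mathfrak{M},X\models p$ iff $X\subseteq V(p)$; $\mathfrak{M},X\models\bot$ iff $X=\emptyset$; $\mathfrak{M},X\models\neg\alpha$ iff $\mathfrak{M},\{w\}\not\models\alpha$ for all $w\in X$. - $\mathfrak{M},X\models\phi\wedge\psi$ iff $\mathfrak{M},X\models\phi$ and $\mathfrak{M},X\models\psi$. - $\mathfrak{M},X\models\phi\otimes\psi$ iff $X=Y\cup Z$ for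 some $Y,Z\subseteq X$ with $\mathfrak{M},Y\models\phi$, $\mathfrak{M},Z\models\psi$. - $\mathfrak{M},X\models\Box\phi$ iff $\mathfrak{M},R(X)\models\phi$; $\mathfrak{M},X\models\Diamond\phi$ iff there is $Y\subseteq W$ with $XRY$ and $\mathfrak{M},Y\models\phi$. - $\mathfrak{M},X\models\;=\!(\alpha_1,\dots,\alpha_n,\beta)$ iff for all $w,u\in X$: if ($\mathfrak{M},\{w\}\models\alpha_i\Leftrightarrow\mathfrak{M},\{u\}\models\alpha_i$) for all $1\le i\le n$, then ($\mathfrak{M},\{w\}\models\beta\Leftrightarrow\mathfrak{M},\{u\}\models\beta$). $\Gamma\models\phi$ means: for all models $\mathfrak{M}$ and teams $X$, if $\mathfrak{M},X\models\gamma$ for all $\gamma\in\Gamma$ then $\mathfrak{M},X\models\phi$. **Natural deduction system of $\mathbf{MD}^+$.** ($\phi,\psi,\chi,\theta$ range over formulas, $\alpha,\alpha_i,\beta$ over classical formulas; $[\cdot]$ marks discharged assumptions; subderivations may use further undischarged assumptions unless stated otherwise.) - Conjunction: from $\phi$ and $\psi$ infer $\phi\wedge\psi$; from $\phi\wedge\psi$ infer $\phi$; from $\phi\wedge\psi$ infer $\psi$. - From $\neg\neg\alpha$ infer $\alpha$; from $\bot$ infer $\phi$. - $\neg$I: from a derivation of $\bot$ from $[\alpha]$ infer $\neg\alpha$. $\neg$E: from $\alpha$ and $\neg\alpha$ infer $\bot$. - $\Box$Mon: from $\Box\phi_1,\dots,\Box\phi_k$ ($k\ge0$) and a derivation of $\psi$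 from $[\phi_1],\dots,[\phi_k]$ having no other undischarged assumptions, infer $\Box\psi$. - $\Diamond$Mon: from $\Diamond\phi$ and a derivation of $\psi$ from $[\phi]$ having no other undischarged assumptions, infer $\Diamond\psi$. - From $\neg\Box\alpha$ infer $\Diamond\neg\alpha$; from $\Diamond\neg\alpha$ infer $\neg\Box\alpha$. - Tensor: from $\phi$ infer $\phi\otimes\psi$; from $\phi\otimes\psi$ infer $\psi\otimes\phi$; from $\phi\otimes(\psi\otimes\chi)$ infer $(\phi\otimes\psi)\otimes\chi$; from $\phi\otimes\psi$, a derivation of $\alpha$ from $[\phi]$ and a derivation of $\alpha$ from $[\psi]$ ($\alpha$ classical), infer $\alpha$; from $\phi\otimes\psi$ and a derivation of $\chi$ from $[\psi]$, infer $\phi\otimes\chi$. - DepI$_0$: from $\alpha$ infer $=\!(\alpha)$; from $\neg\alpha$ infer $=\!(\alpha)$. - DepE$_0$: from $=\!(\alpha)$, a derivation of $\theta$ from $[\alpha]$ and a derivation of $\theta$ from $[\neg\alpha]$, infer $\theta$. - DepI$_k$: from a derivation of $=\!(\beta)$ from $[=\!(\alpha_1)],\dots,[=\!(\alpha_k)]$ infer $=\!(\alpha_1,\dots,\alpha_k,\beta)$. - DepE$_k$: from $=\!(\alpha_1,\dots,\alpha_k,\beta)$, $=\!(\alpha_1)$, ..., $=\!(\alpha_k)$ infer $=\!(\beta)$. - SE: if $\phi$ contains a given occurrence of an atom $=\!(\alpha)$, and $\phi'$, $\phi''$ are obtained from $\phi$ by replacing that occurrence by $\alpha$, respectively by $\neg\alpha$,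 then from $\phi$, a derivation of $\theta$ from $[\phi']$ and a derivation of $\theta$ from $[\phi'']$, infer $\theta$. $\Gamma\vdash_{\mathbf{MD}^+}\phi$ means there is a derivation of $\phi$ all of whose undischarged assumptions belong to $\Gamma$. *)

(* Defs.v *)
From Stdlib Require List.
From mathcomp Require Import all_boot.
From mathcomp Require Import boolp classical_sets.

Set Implicit Arguments.
Unset Strict Implicit.
Unset Printing Implicit Defensive.

Local Open Scope classical_set_scope.

Inductive cform (P : Type) : Type :=
| CVar of P
| CBot
| CNeg of cform P
| CAnd of cform P & cform P
| CTensor of cform P & cform P
| CBox of cform P
| CDia of cform P.

Arguments CBot {P}.

(* Classical formulas are a subset of the formulas, via [emb] below.  There is
   deliberately no constructor injecting [cform] into [form]: a conjunction of
   two classical formulas is then one and the same formula, whether it is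
   built in [cform] or in [form]. *)
Inductive form (P : Type) : Type :=
| Var of P
| Bot
| Neg of cform P
| Dep of seq (cform P) & cform P
| And of form P & form P
| Tensor of form P & form P
| Box of form P
| Dia of form P.

Arguments Bot {P}.

Fixpoint emb (P : Type) (a : cform P) : form P :=
  match a with
  | CVar p => Var p
  | CBot => Bot
  | CNeg a => Neg a
  | CAnd a b => And (emb a) (emb b)
  | CTensor a b => Tensor (emb a) (emb b)
  | CBox a => Box (emb a)
  | CDia a => Dia (emb a)
  end.

Coercion emb : cform >-> form.

Lemma emb_inj (P : Type) : injective (@emb P).
Proof.
elim=> [p||a IHa|a IHa b IHb|a IHa b IHb|a IHa|a IHa] [q||c|c d|c d|c|c] //=.
- by case=> ->.
- by case=> ->.
- by case=> /IHa -> /IHb ->.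
- by case=> /IHa -> /IHb ->.
- by case=> /IHa ->.
- by case=> /IHa ->.
Qed.

Record model (P : Type) : Type := Model {
  world : Type;
  world_inhabited : inhabited world;
  acc : world -> world -> Prop;
  valuation : P -> set world
}.

Section Semantics.
Variables (P : Type) (M : model P).
Implicit Types X Y Z : set (world M).

Definition succ X : set (world M) := [set w | exists2 v, X v & acc v w].

Definition team_acc X Y : Prop :=
  Y `<=` succ X /\ forall w, X w -> Y `&` succ [set w] !=set0.

(* In the tensor clause, Y and Z are subsets of X because X = Y `|` Z. *)
Fixpoint csat (a : cform P) : set (world M) -> Prop :=
  match a with
  | CVar p => fun X => X `<=` valuation p
  | CBot => fun X => X = set0
  | CNeg a => fun X => forall w, X w -> ~ csat a [set w]
  | CAnd a b => fun X => csat a X /\ csat b X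
  | CTensor a b => fun X =>
      exists Y Z, [/\ X = Y `|` Z, csat a Y & csat b Z]
  | CBox a => fun X => csat a (succ X)
  | CDia a => fun X => exists2 Y, team_acc X Y & csat a Y
  end.

Fixpoint sat (phi : form P) : set (world M) -> Prop :=
  match phi with
  | Var p => fun X => X `<=` valuation p
  | Bot => fun X => X = set0
  | Neg a => fun X => forall w, X w -> ~ csat a [set w]
  | Dep s b => fun X => forall w u, X w -> X u ->
      (forall a, List.In a s -> (csat a [set w] <-> csat a [set u])) ->
      (csat b [set w] <-> csat b [set u])
  | And phi psi => fun X => sat phi X /\ sat psi X
  | Tensor phi psi => fun X =>
      exists Y Z, [/\ X = Y `|` Z, sat phi Y & sat psi Z]
  | Box phi => fun X => sat phi (succ X)
  | Dia phi => fun X => exists2 Y, team_acc X Y & sat phi Y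
  end.

Lemma sat_emb (a : cform P) : sat a = csat a.
Proof. by elim: a => //= [a -> b ->|a -> b ->|a ->|a ->]. Qed.

End Semantics.

Definition entails (P : Type) (Gamma : set (form P)) (phi : form P) : Prop :=
  forall (M : model P) (X : set (world M)),
    (forall gamma, Gamma gamma -> sat gamma X) -> sat phi X.

(* One-hole contexts: an occurrence of a subformula psi of phi is a context C
   with phi = plug C psi.  A dependence atom cannot occur inside a negation or
   inside another dependence atom, so those have no context former. *)
Inductive ctx (P : Type) : Type :=
| Hole
| AndL of ctx P & form P
| AndR of form P & ctx P
| TensorL of ctx P & form P
| TensorR of form P & ctx P
| BoxC of ctx P
| DiaC of ctx P.

Arguments Hole {P}.

Fixpoint plug (P : Type) (C : ctx P) (psi : form P) : form P :=
  match C with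
  | Hole => psi
  | AndL C phi => And (plug C psi) phi
  | AndR phi C => And phi (plug C psi)
  | TensorL C phi => Tensor (plug C psi) phi
  | TensorR phi C => Tensor phi (plug C psi)
  | BoxC C => Box (plug C psi)
  | DiaC C => Dia (plug C psi)
  end.

(* [derivable Gamma phi]: there is a natural deduction derivation of phi all of
   whose undischarged assumptions belong to Gamma.  A rule discharging [psi]
   has a premise whose set of assumptions is psi |` Gamma; in the rules BoxMon
   and DiaMon the subderivation cannot use Gamma. *)
Inductive derivable (P : Type) : set (form P) -> form P -> Prop :=
| Assume (Gamma : set (form P)) phi :
    Gamma phi -> derivable Gamma phi
| AndI Gamma phi psi :
    derivable Gamma phi -> derivable Gamma psi -> derivable Gamma (And phi psi)
| AndE1 Gamma phi psi :
    derivable Gamma (And phi psi) -> derivable Gamma phi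
| AndE2 Gamma phi psi :
    derivable Gamma (And phi psi) -> derivable Gamma psi
| NegNegE Gamma (a : cform P) :
    derivable Gamma (Neg (CNeg a)) -> derivable Gamma a
| BotE Gamma phi :
    derivable Gamma Bot -> derivable Gamma phi
| NegI Gamma (a : cform P) :
    derivable (emb a |` Gamma) Bot -> derivable Gamma (Neg a)
| NegE Gamma (a : cform P) :
    derivable Gamma a -> derivable Gamma (Neg a) -> derivable Gamma Bot
| BoxMon Gamma (s : seq (form P)) psi :
    (forall phi, List.In phi s -> derivable Gamma (Box phi)) ->
    derivable [set phi | List.In phi s] psi ->
    derivable Gamma (Box psi)
| DiaMon Gamma phi psi :
    derivable Gamma (Dia phi) -> derivable [set phi] psi ->
    derivable Gamma (Dia psi)
| NegBoxE Gamma (a : cform P) :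
    derivable Gamma (Neg (CBox a)) -> derivable Gamma (Dia (Neg a))
| NegBoxI Gamma (a : cform P) :
    derivable Gamma (Dia (Neg a)) -> derivable Gamma (Neg (CBox a))
| TensorI Gamma phi psi :
    derivable Gamma phi -> derivable Gamma (Tensor phi psi)
| TensorC Gamma phi psi :
    derivable Gamma (Tensor phi psi) -> derivable Gamma (Tensor psi phi)
| TensorA Gamma phi psi chi :
    derivable Gamma (Tensor phi (Tensor psi chi)) ->
    derivable Gamma (Tensor (Tensor phi psi) chi)
| TensorE Gamma phi psi (a : cform P) :
    derivable Gamma (Tensor phi psi) ->
    derivable (phi |` Gamma) a -> derivable (psi |` Gamma) a ->
    derivable Gamma a
| TensorSub Gamma phi psi chi :
    derivable Gamma (Tensor phi psi) -> derivable (psi |` Gamma) chi ->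
    derivable Gamma (Tensor phi chi)
| DepI0 Gamma (a : cform P) :
    derivable Gamma a -> derivable Gamma (Dep [::] a)
| DepI0N Gamma (a : cform P) :
    derivable Gamma (Neg a) -> derivable Gamma (Dep [::] a)
| DepE0 Gamma (a : cform P) theta :
    derivable Gamma (Dep [::] a) ->
    derivable (emb a |` Gamma) theta -> derivable (Neg a |` Gamma) theta ->
    derivable Gamma theta
| DepI Gamma (s : seq (cform P)) (b : cform P) :
    derivable ([set phi | exists2 a, List.In a s & phi = Dep [::] a] `|` Gamma)
      (Dep [::] b) ->
    derivable Gamma (Dep s b)
| DepE Gamma (s : seq (cform P)) (b : cform P) :
    derivable Gamma (Dep s b) ->
    (forall a, List.In a s -> derivable Gamma (Dep [::] a)) ->
    derivable Gamma (Dep [::] b)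
| SE Gamma (C : ctx P) (a : cform P) theta :
    derivable Gamma (plug C (Dep [::] a)) ->
    derivable (plug C a |` Gamma) theta ->
    derivable (plug C (Neg a) |` Gamma) theta ->
    derivable Gamma theta.

(* Main.v *)
(* A formula is semantically the global disjunction of its realizations, the
   classical formulas obtained by deciding each dependence atom.  Every
   realization of phi derives phi, and SE allows a case distinction on the
   realizations of phi.  If phi is not derivable from Gamma, extend Gamma to a
   set Delta maximal among those not deriving phi: then Delta contains a
   realization of each of its members.  In the canonical model, let X be the
   team of all maximal consistent sets extending Delta; by flatness of classical
   formulas, X satisfies Delta.  Were phi true on X, so would be one of its
   realizations r; but Delta does not derive r, so some member of X contains
   the negation of r. *)

Require Import Defs.
From mathcomp Require Import all_boot.
From mathcomp Require Import boolp classical_sets.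

Set Implicit Arguments.
Unset Strict Implicit.
Unset Printing Implicit Defensive.

Local Open Scope classical_set_scope.

(** * Team semantics *)

Lemma succ_sub (P : Type) (M : model P) (X Y : set (world M)) :
  X `<=` Y -> succ X `<=` succ Y.
Proof. by move=> sXY w [v /sXY Yv vw]; exists v. Qed.

(** Downward closure: every witness for a team restricts to a subteam. *)
Lemma sat_sub (P : Type) (M : model P) (phi : form P) (X Y : set (world M)) :
  Y `<=` X -> sat phi X -> sat phi Y.
Proof.
elim: phi X Y => [p||a|s b|phi IHphi psi IHpsi|phi IHphi psi IHpsi|phi IH|phi IH]
  X Y sYX /=.
- exact: subset_trans.
- by move=> X0; apply/seteqP; split=> // w /sYX; rewrite X0.
- by move=> nX w /sYX; apply: nX.
- by move=> dX w u /sYX Xw /sYX; apply: dX.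
- by move=> [/(IHphi _ _ sYX) ? /(IHpsi _ _ sYX) ?].
- move=> [X1 [X2 [eX s1 s2]]]; exists (Y `&` X1), (Y `&` X2); split.
  + by rewrite -setIUr -eX; apply/esym/setIidPl.
  + by apply: IHphi s1; apply: subIsetr.
  + by apply: IHpsi s2; apply: subIsetr.
- exact/IH/succ_sub.
(* The witness is cut down to the successors of [Y]; the successor that it supplies for a point of
   [Y] survives the cut. *)
- move=> [Z [sZ hZ] sat_Z]; exists (Z `&` succ Y); last first.
    by apply: IH sat_Z; apply: subIsetl.
  split; first exact: subIsetr.
  move=> w Yw; have [v [Zv wv]] := hZ w (sYX w Yw).
  by exists v; split=> //; split=> //; apply: succ_sub wv => _ ->.
Qed.

Lemma sat_set0 (P : Type) (M : model P) (phi : form P) :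
  sat phi (set0 : set (world M)).
Proof.
have succ0 : succ set0 = set0 :> set (world M).
  by apply/seteqP; split=> // w [].
elim: phi => //= [p|phi IHphi psi IHpsi|phi|phi IH].
- exact: sub0set.
- by exists set0, set0; rewrite setU0.
- by rewrite succ0.
- by exists set0 => //; split=> // w [].
Qed.

(** Flatness. One direction is downward closure. For the other, the largest candidates serve as
    witnesses: a tensor splits [X] into the points satisfying each side, and a diamond takes all
    successors satisfying [a]. *)
Lemma csat_flat (P : Type) (M : model P) (a : cform P) (X : set (world M)) :
  csat a X <-> forall w, X w -> csat a [set w].
Proof.
split=> [aX w Xw|].
  by move: aX; rewrite -!sat_emb; apply: sat_sub => _ ->.
elim: a X => [p||a IH|a IHa b IHb|a IHa b IHb|a IH|a IH] X /= aX.
- by move=> w /aX; apply.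
- apply/seteqP; split=> // w /aX w0.
  by rewrite -w0.
- by move=> w /aX; apply.
- by split; [apply: IHa|apply: IHb] => w /aX [].
- exists (X `&` [set w | csat a [set w]]), (X `&` [set w | csat b [set w]]).
  split; last 2 first.
  + by apply: IHa => w [].
  + by apply: IHb => w [].
  apply/seteqP; split=> [w Xw|w [[]|[]]//].
  have [Y [Z [eYZ aY bZ]]] := aX w Xw.
  have : (Y `|` Z) w by rewrite -eYZ.
  by case=> [Yw|Zw]; [left|right]; split=> //=; rewrite -sat_emb;
    [apply: (@sat_sub _ _ _ Y)|apply: (@sat_sub _ _ _ Z)];
    rewrite ?sat_emb // => _ ->.
- apply: IH => v [u Xu uv]; rewrite -sat_emb.
  apply: (@sat_sub _ _ _ (succ [set u])); last by rewrite sat_emb; apply: aX.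
  by move=> _ ->; exists u.
- exists (succ X `&` [set v | csat a [set v]]); last by apply: IH => v [].
  split; first exact: subIsetl.
  move=> w Xw; have [Y [sY hY] aY] := aX w Xw.
  have [v [Yv wv]] := hY w erefl.
  exists v; split=> //; split; first by apply: succ_sub wv => _ ->.
  by rewrite /= -sat_emb; apply: (@sat_sub _ _ _ Y); rewrite ?sat_emb // => _ ->.
Qed.

(** Here and in the next three lemmas, team semantics on singletons becomes ordinary Kripke
    semantics. *)
Lemma csat_neg (P : Type) (M : model P) (a : cform P) (w : world M) :
  csat (CNeg a) [set w] <-> ~ csat a [set w].
Proof. by split=> [/(_ w erefl)//|na _ ->]. Qed.

Lemma csat_tensor (P : Type) (M : model P) (a b : cform P) (w : world M) :
  csat (CTensor a b) [set w] <-> csat a [set w] \/ csat b [set w].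
Proof.
split=> [[Y [Z [eYZ /csat_flat aY /csat_flat bZ]]]|].
  have : (Y `|` Z) w by rewrite -eYZ.
  by case=> [/aY|/bZ]; [left|right].
by case=> [aw|bw]; [exists [set w], set0|exists set0, [set w]];
  rewrite ?setU0 ?set0U; split=> //; rewrite -sat_emb; apply: sat_set0.
Qed.

Lemma csat_box (P : Type) (M : model P) (a : cform P) (w : world M) :
  csat (CBox a) [set w] <-> forall v, acc w v -> csat a [set v].
Proof.
rewrite /= csat_flat; split=> [h v wv|h v [u -> uv]].
  by apply: h; exists w.
exact: h.
Qed.

Lemma csat_dia (P : Type) (M : model P) (a : cform P) (w : world M) :
  csat (CDia a) [set w] <-> exists2 v, acc w v & csat a [set v].
Proof.
split=> [[Y [sY hY] /csat_flat aY]|[v wv av]].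
  by have [v [Yv [_ -> wv]]] := hY w erefl; exists v => //; apply: aY.
exists [set v] => //; split=> [_ ->|_ ->]; first by exists w.
by exists v; split=> //; exists w.
Qed.

(* Every connective distributes over the two ways a team can satisfy =(a). *)
Lemma sat_plug_dep (P : Type) (M : model P) (C : ctx P) (a : cform P)
    (X : set (world M)) :
  sat (plug C (Dep [::] a)) X -> sat (plug C a) X \/ sat (plug C (Neg a)) X.
Proof.
elim: C X => [|C IH phi|phi C IH|C IH phi|phi C IH|C IH|C IH] X /=.
- move=> dX; have [[w [Xw aw]]|na] := pselect (exists w, X w /\ csat a [set w]).
    left; rewrite sat_emb; apply/csat_flat => u Xu.
    by apply/(dX w u).
  by right=> w Xw aw; apply: na; exists w.
- by move=> [/IH[] ? ?]; [left|right].
- by move=> [? /IH[] ?]; [left|right].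
- by move=> [Y [Z [eX /IH[] sY sZ]]]; [left|right]; exists Y, Z.
- by move=> [Y [Z [eX sY /IH[] sZ]]]; [left|right]; exists Y, Z.
- exact: IH.
- by move=> [Y XY /IH[] sY]; [left|right]; exists Y.
Qed.

(** * Soundness *)

(** Downward closure carries the undischarged assumptions to the subteams on which discharged ones
    are tested. Flatness reassembles classical conclusions, and [sat_plug_dep] validates [DepE0] and
    [SE]. *)
Lemma soundness (P : Type) (Gamma : set (form P)) (phi : form P) :
  derivable Gamma phi -> entails Gamma phi.
Proof.
have satU (M : model P) (X Y : set (world M)) Delta psi :
    Y `<=` X -> (forall g, Delta g -> sat g X) -> sat psi Y ->
    forall g, (psi |` Delta) g -> sat g Y.
  by move=> sYX DX psiY g [->//|/DX]; apply: sat_sub.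
have sub1 (M : model P) (X : set (world M)) w : X w -> [set w] `<=` X.
  by move=> Xw _ ->.
elim=> {Gamma phi}.
- by move=> Gamma phi Gphi M X; apply.
- by move=> Gamma phi psi _ IH1 _ IH2 M X GX; split; [apply: IH1|apply: IH2].
- by move=> Gamma phi psi _ IH M X /IH[].
- by move=> Gamma phi psi _ IH M X /IH[].
- move=> Gamma a _ IH M X /IH /= h; rewrite sat_emb; apply/csat_flat => w /h.
  by move=> nna; apply: contrapT => na; apply: nna => _ ->.
- by move=> Gamma phi _ IH M X /IH /= ->; apply: sat_set0.
- move=> Gamma a _ IH M X GX w Xw aw.
  have : [set w] = set0 :> set (world M).
    by apply: IH; apply: satU GX _; [apply: sub1|rewrite sat_emb].
  by move/seteqP => [/(_ w erefl)].
- move=> Gamma a _ IH1 _ IH2 M X GX /=; apply/seteqP; split=> // w Xw.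
  have := IH2 M X GX w Xw; apply; rewrite -sat_emb.
  by apply: sat_sub (IH1 M X GX); apply: sub1.
- move=> Gamma s psi _ IHs _ IH M X GX /=; apply: IH => phi sphi.
  exact: (IHs phi sphi M X GX).
- move=> Gamma phi psi _ IH1 _ IH2 M X /IH1 [Y XY sY]; exists Y => //.
  by apply: IH2 => _ ->.
- move=> Gamma a _ IH M X /IH nX.
  exists (succ X `&` [set v | ~ csat a [set v]]); last by move=> v [].
  split; first exact: subIsetl.
  move=> w Xw; apply: contrapT => nex; apply: (nX w Xw).
  apply/csat_box => v wv; apply: contrapT => nv; apply: nex.
  by exists v; do 2?split=> //; exists w.
- move=> Gamma a _ IH M X /IH [Y [sY hY] nY] w Xw /csat_box aw.
  by have [v [Yv [_ -> wv]]] := hY w Xw; apply: (nY v Yv); apply: aw.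
- move=> Gamma phi psi _ IH M X /IH sX; exists X, set0; rewrite setU0.
  by split=> //; apply: sat_set0.
- move=> Gamma phi psi _ IH M X /IH [Y [Z [eX sY sZ]]].
  by exists Z, Y; rewrite setUC.
- move=> Gamma phi psi chi _ IH M X /IH [Y [W [eX sY [Z [Z' [eW sZ sZ']]]]]].
  by exists (Y `|` Z), Z'; rewrite -setUA -eW; split=> //; exists Y, Z.
- move=> Gamma phi psi a _ IH _ IH1 _ IH2 M X GX.
  have [Y [Z [eX sY sZ]]] := IH M X GX.
  have sYX : Y `<=` X by rewrite eX; apply: subsetUl.
  have sZX : Z `<=` X by rewrite eX; apply: subsetUr.
  have := IH1 M Y (satU _ _ _ _ _ sYX GX sY).
  have := IH2 M Z (satU _ _ _ _ _ sZX GX sZ).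
  rewrite !sat_emb => /csat_flat aZ /csat_flat aY; apply/csat_flat => w.
  by rewrite eX => -[/aY|/aZ].
- move=> Gamma phi psi chi _ IH _ IH1 M X GX.
  have [Y [Z [eX sY sZ]]] := IH M X GX; exists Y, Z; split=> //.
  by apply: IH1; apply: satU GX sZ; rewrite eX; apply: subsetUr.
- move=> Gamma a _ IH M X /IH; rewrite sat_emb => /csat_flat aX w u Xw Xu _.
  by split=> _; apply: aX.
- by move=> Gamma a _ IH M X /IH naX w u Xw Xu _; split=> /naX[].
- move=> Gamma a theta _ IH _ IH1 _ IH2 M X GX.
  by have /(@sat_plug_dep _ _ Hole)[aX|naX] := IH M X GX;
    [apply: IH1|apply: IH2]; apply: satU GX _.
- move=> Gamma s b _ IH M X GX w u Xw Xu wu.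
  (* On this two-point team, agreement of [w] and [u] on the formulas of [s] is exactly constancy of
     each of them. *)
  apply: (IH M [set w; u]) => //; [|by left|by right].
  move=> g [[a sa ->]|/GX sX]; last by apply: sat_sub sX => _ [] ->.
  by have awu := wu a sa; move=> _ _ [->|->] [->|->] _; rewrite ?awu.
- move=> Gamma s b _ IH _ IHs M X GX w u Xw Xu _.
  by apply: (IH M X GX w u Xw Xu) => a sa; apply: (IHs a sa M X GX w u Xw Xu).
- move=> Gamma C a theta _ IH _ IH1 _ IH2 M X GX.
  by have /sat_plug_dep[aX|naX] := IH M X GX;
    [apply: IH1|apply: IH2]; apply: satU GX _.
Qed.

(** * Structural properties of derivability *)

Lemma derivable_sub (P : Type) (Gamma Delta : set (form P)) (phi : form P) :
  Gamma `<=` Delta -> derivable Gamma phi -> derivable Delta phi.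
Proof.
move=> sGD d; elim: d Delta sGD => {Gamma phi}.
- by move=> Gamma phi Gphi Delta sGD; apply/Assume/sGD.
- by move=> Gamma phi psi _ IH1 _ IH2 Delta sGD; apply: AndI; [apply: IH1|apply: IH2].
- by move=> Gamma phi psi _ IH Delta sGD; apply: AndE1 (IH _ sGD).
- by move=> Gamma phi psi _ IH Delta sGD; apply: AndE2 (IH _ sGD).
- by move=> Gamma a _ IH Delta sGD; apply: NegNegE (IH _ sGD).
- by move=> Gamma phi _ IH Delta sGD; apply: BotE (IH _ sGD).
- by move=> Gamma a _ IH Delta sGD; apply: NegI; apply: IH; apply: setUS.
- by move=> Gamma a _ IH1 _ IH2 Delta sGD; apply: NegE (IH1 _ sGD) (IH2 _ sGD).
- move=> Gamma s psi _ IHs d _ Delta sGD; apply: BoxMon d => phi sphi.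
  exact: IHs.
- by move=> Gamma phi psi _ IH d _ Delta sGD; apply: DiaMon d; apply: IH.
- by move=> Gamma a _ IH Delta sGD; apply: NegBoxE (IH _ sGD).
- by move=> Gamma a _ IH Delta sGD; apply: NegBoxI (IH _ sGD).
- by move=> Gamma phi psi _ IH Delta sGD; apply: TensorI (IH _ sGD).
- by move=> Gamma phi psi _ IH Delta sGD; apply: TensorC (IH _ sGD).
- by move=> Gamma phi psi chi _ IH Delta sGD; apply: TensorA (IH _ sGD).
- move=> Gamma phi psi a _ IH _ IH1 _ IH2 Delta sGD.
  by apply: TensorE (IH _ sGD) (IH1 _ _) (IH2 _ _); apply: setUS.
- move=> Gamma phi psi chi _ IH _ IH1 Delta sGD.
  by apply: TensorSub (IH _ sGD) (IH1 _ _); apply: setUS.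
- by move=> Gamma a _ IH Delta sGD; apply: DepI0 (IH _ sGD).
- by move=> Gamma a _ IH Delta sGD; apply: DepI0N (IH _ sGD).
- move=> Gamma a theta _ IH _ IH1 _ IH2 Delta sGD.
  by apply: DepE0 (IH _ sGD) (IH1 _ _) (IH2 _ _); apply: setUS.
- by move=> Gamma s b _ IH Delta sGD; apply: DepI; apply: IH; apply: setUS.
- move=> Gamma s b _ IH _ IHs Delta sGD; apply: DepE (IH _ sGD) _ => a sa.
  exact: IHs.
- move=> Gamma C a theta _ IH _ IH1 _ IH2 Delta sGD.
  by apply: SE (IH _ sGD) (IH1 _ _) (IH2 _ _); apply: setUS.
Qed.

(** There is no implication through which to cut, so derivations are substituted for assumptions by
    induction. The closed subderivations of [BoxMon] and [DiaMon] stay untouched. *)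
Lemma derivable_cut (P : Type) (Gamma Delta : set (form P)) (phi : form P) :
  (forall psi, Gamma psi -> derivable Delta psi) -> derivable Gamma phi ->
  derivable Delta phi.
Proof.
have liftU (A Gamma' Delta' : set (form P)) :
    (forall psi, Gamma' psi -> derivable Delta' psi) ->
    forall psi, (A `|` Gamma') psi -> derivable (A `|` Delta') psi.
  move=> GD psi [Apsi|/GD]; first by apply: Assume; left.
  by apply: derivable_sub; apply: subsetUr.
move=> GD d; elim: d Delta GD => {Gamma phi}.
- by move=> Gamma phi Gphi Delta; apply.
- by move=> Gamma phi psi _ IH1 _ IH2 Delta GD; apply: AndI; [apply: IH1|apply: IH2].
- by move=> Gamma phi psi _ IH Delta GD; apply: AndE1 (IH _ GD).
- by move=> Gamma phi psi _ IH Delta GD; apply: AndE2 (IH _ GD).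
- by move=> Gamma a _ IH Delta GD; apply: NegNegE (IH _ GD).
- by move=> Gamma phi _ IH Delta GD; apply: BotE (IH _ GD).
- by move=> Gamma a _ IH Delta GD; apply: NegI; apply: IH; apply: liftU.
- by move=> Gamma a _ IH1 _ IH2 Delta GD; apply: NegE (IH1 _ GD) (IH2 _ GD).
- by move=> Gamma s psi _ IHs d _ Delta GD; apply: BoxMon d => phi sphi; apply: IHs.
- by move=> Gamma phi psi _ IH d _ Delta GD; apply: DiaMon d; apply: IH.
- by move=> Gamma a _ IH Delta GD; apply: NegBoxE (IH _ GD).
- by move=> Gamma a _ IH Delta GD; apply: NegBoxI (IH _ GD).
- by move=> Gamma phi psi _ IH Delta GD; apply: TensorI (IH _ GD).
- by move=> Gamma phi psi _ IH Delta GD; apply: TensorC (IH _ GD).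
- by move=> Gamma phi psi chi _ IH Delta GD; apply: TensorA (IH _ GD).
- move=> Gamma phi psi a _ IH _ IH1 _ IH2 Delta GD.
  by apply: TensorE (IH _ GD) (IH1 _ _) (IH2 _ _); apply: liftU.
- move=> Gamma phi psi chi _ IH _ IH1 Delta GD.
  by apply: TensorSub (IH _ GD) (IH1 _ _); apply: liftU.
- by move=> Gamma a _ IH Delta GD; apply: DepI0 (IH _ GD).
- by move=> Gamma a _ IH Delta GD; apply: DepI0N (IH _ GD).
- move=> Gamma a theta _ IH _ IH1 _ IH2 Delta GD.
  by apply: DepE0 (IH _ GD) (IH1 _ _) (IH2 _ _); apply: liftU.
- by move=> Gamma s b _ IH Delta GD; apply: DepI; apply: IH; apply: liftU.
- move=> Gamma s b _ IH _ IHs Delta GD; apply: DepE (IH _ GD) _ => a sa.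
  exact: IHs.
- move=> Gamma C a theta _ IH _ IH1 _ IH2 Delta GD.
  by apply: SE (IH _ GD) (IH1 _ _) (IH2 _ _); apply: liftU.
Qed.

Lemma derivable_trans (P : Type) (Gamma : set (form P)) (phi psi : form P) :
  derivable Gamma phi -> derivable (phi |` Gamma) psi -> derivable Gamma psi.
Proof. by move=> d; apply: derivable_cut => chi [->//|]; apply: Assume. Qed.

Lemma derivable1_trans (P : Type) (Gamma : set (form P)) (phi psi : form P) :
  derivable Gamma phi -> derivable [set phi] psi -> derivable Gamma psi.
Proof. by move=> d; apply: derivable_cut => chi ->. Qed.

Lemma assumeU1 (P : Type) (Gamma : set (form P)) (phi : form P) :
  derivable (phi |` Gamma) phi.
Proof. by apply: Assume; left. Qed.

Lemma weakenU1 (P : Type) (Gamma : set (form P)) (phi psi : form P) :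
  derivable Gamma psi -> derivable (phi |` Gamma) psi.
Proof. by apply: derivable_sub; apply: subsetUr. Qed.

(** * Finitely many assumptions suffice *)

(** As [Q] is monotone, the finite supports of the members of [s] can be concatenated. This serves
    the rules with a list of premises, [BoxMon] and [DepE]. *)
Lemma finite_choice (A B : Type) (Gamma : set B) (Q : A -> set B -> Prop)
    (s : seq A) :
  (forall x U V, U `<=` V -> Q x U -> Q x V) ->
  (forall x, List.In x s -> exists2 l : seq B,
    (forall y, List.In y l -> Gamma y) & Q x [set y | List.In y l]) ->
  exists2 l : seq B, (forall y, List.In y l -> Gamma y) &
    forall x, List.In x s -> Q x [set y | List.In y l].
Proof.
move=> monQ; elim: s => [|x s IH] h; first by exists [::].
have [l1 G1 Q1] := h x (or_introl erefl).
have [l2 G2 Q2] := IH (fun y sy => h y (or_intror sy)).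
exists (l1 ++ l2) => [y /List.in_app_iff[]//|]; first exact: G1.
  exact: G2.
move=> y [<-|/Q2 Qy].
- by apply: monQ Q1 => z lz; apply/List.in_app_iff; left.
- by apply: monQ Qy => z lz; apply/List.in_app_iff; right.
Qed.

Lemma finite_split (B : Type) (A Gamma : set B) (l : seq B) :
  (forall y, List.In y l -> (A `|` Gamma) y) ->
  exists2 l' : seq B, (forall y, List.In y l' -> Gamma y) &
    [set y | List.In y l] `<=` A `|` [set y | List.In y l'].
Proof.
move=> h; have [] := @finite_choice _ _ Gamma (fun y U => (A `|` U) y) l.
- by move=> x U V sUV [Ax|/sUV Vx]; [left|right].
- move=> x /h [Ax|Gx]; first by exists [::] => //; left.
  by exists [:: x] => [y [<-|]//|]; right; left.
- by move=> l' Gl' hl'; exists l'.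
Qed.

Definition fin_derivable (P : Type) (Gamma : set (form P)) (phi : form P) :=
  exists2 l : seq (form P), (forall y, List.In y l -> Gamma y) &
    derivable [set y | List.In y l] phi.

Lemma derivable_finite (P : Type) (Gamma : set (form P)) (phi : form P) :
  derivable Gamma phi -> fin_derivable Gamma phi.
Proof.
have fin2 (Delta : set (form P)) (phi1 phi2 psi : form P) :
    fin_derivable Delta phi1 -> fin_derivable Delta phi2 ->
    (forall U, derivable U phi1 -> derivable U phi2 -> derivable U psi) ->
    fin_derivable Delta psi.
  move=> [l1 G1 d1] [l2 G2 d2] h; exists (l1 ++ l2).
    by move=> y /List.in_app_iff[/G1|/G2].
  by apply: h; [apply: derivable_sub d1|apply: derivable_sub d2] => y ly;
    apply/List.in_app_iff; [left|right].
have fin1 (Delta : set (form P)) (phi1 psi : form P) :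
    fin_derivable Delta phi1 ->
    (forall U, derivable U phi1 -> derivable U psi) ->
    fin_derivable Delta psi.
  by move=> [l G d] h; exists l => //; apply: h.
have finU (A Delta : set (form P)) psi : fin_derivable (A `|` Delta) psi ->
    exists2 l : seq (form P), (forall y, List.In y l -> Delta y) &
      derivable (A `|` [set y | List.In y l]) psi.
  move=> [l G d]; have [l' G' sl'] := finite_split G.
  by exists l' => //; apply: derivable_sub d.
have finU2 (A B Delta : set (form P)) phi1 phi2 phi3 psi :
    fin_derivable Delta phi1 -> fin_derivable (A `|` Delta) phi2 ->
    fin_derivable (B `|` Delta) phi3 ->
    (forall U, derivable U phi1 -> derivable (A `|` U) phi2 ->
      derivable (B `|` U) phi3 -> derivable U psi) ->
    fin_derivable Delta psi.
  move=> [l1 G1 d1] /finU [l2 G2 d2] /finU [l3 G3 d3] h.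
  exists (l1 ++ l2 ++ l3).
    by move=> y /List.in_app_iff[/G1|/List.in_app_iff[/G2|/G3]].
  apply: h; [apply: derivable_sub d1|apply: derivable_sub d2|
             apply: derivable_sub d3]; try apply: setUS;
    by move=> y ly; rewrite /= !List.in_app_iff; auto.
elim=> {Gamma phi}.
- move=> Gamma phi Gphi; exists [:: phi] => [y [<-|]//|].
  by apply: Assume; left.
- by move=> Gamma phi psi _ IH1 _ IH2; apply: fin2 IH1 IH2 _ => U; apply: AndI.
- by move=> Gamma phi psi _ /fin1; apply=> U; apply: AndE1.
- by move=> Gamma phi psi _ /fin1; apply=> U; apply: AndE2.
- by move=> Gamma a _ /fin1; apply=> U; apply: NegNegE.
- by move=> Gamma phi _ /fin1; apply=> U; apply: BotE.
- by move=> Gamma a _ /finU [l G d]; exists l => //; apply: NegI.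
- by move=> Gamma a _ IH1 _ IH2; apply: fin2 IH1 IH2 _ => U; apply: NegE.
- move=> Gamma s psi _ IHs d _.
  have [] := @finite_choice _ _ Gamma (fun x U => derivable U (Box x)) s.
  + by move=> x U V; apply: derivable_sub.
  + exact: IHs.
  + by move=> l G ds; exists l => //; apply: BoxMon d.
- by move=> Gamma phi psi _ /fin1 IH d _; apply: IH => U dU; apply: DiaMon d.
- by move=> Gamma a _ /fin1; apply=> U; apply: NegBoxE.
- by move=> Gamma a _ /fin1; apply=> U; apply: NegBoxI.
- by move=> Gamma phi psi _ /fin1; apply=> U; apply: TensorI.
- by move=> Gamma phi psi _ /fin1; apply=> U; apply: TensorC.
- by move=> Gamma phi psi chi _ /fin1; apply=> U; apply: TensorA.
- by move=> Gamma phi psi a _ IH _ IH1 _ IH2; apply: finU2 IH IH1 IH2 _ => U;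
    apply: TensorE.
- move=> Gamma phi psi chi _ IH _ IH1.
  (* [finU2] expects two discharging premises; the only one is supplied twice. *)
  by apply: (finU2 _ _ _ _ _ _ _ IH IH1 IH1) => U d d1 _; apply: TensorSub d d1.
- by move=> Gamma a _ /fin1; apply=> U; apply: DepI0.
- by move=> Gamma a _ /fin1; apply=> U; apply: DepI0N.
- by move=> Gamma a theta _ IH _ IH1 _ IH2; apply: finU2 IH IH1 IH2 _ => U;
    apply: DepE0.
- by move=> Gamma s b _ /finU [l G d]; exists l => //; apply: DepI.
- move=> Gamma s b _ [l G d] _ IHs.
  have [] := @finite_choice _ _ Gamma (fun x U => derivable U (Dep [::] x)) s.
  + by move=> x U V; apply: derivable_sub.
  + exact: IHs.
  + move=> l' G' ds; exists (l ++ l').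
      by move=> y /List.in_app_iff[/G|/G'].
    apply: (DepE (s := s)) => [|a sa].
      by apply: derivable_sub d => y ly; apply/List.in_app_iff; left.
    by apply: derivable_sub (ds a sa) => y ly; apply/List.in_app_iff; right.
- by move=> Gamma C a theta _ IH _ IH1 _ IH2; apply: finU2 IH IH1 IH2 _ => U;
    apply: SE.
Qed.

(** * Derived rules *)

Lemma derivable_raa (P : Type) (Gamma : set (form P)) (a : cform P) :
  derivable (Neg a |` Gamma) Bot -> derivable Gamma a.
Proof. by move=> d; apply: NegNegE; apply: (@NegI _ _ (CNeg a)). Qed.

Lemma derivable_em (P : Type) (Gamma : set (form P)) (a : cform P) :
  derivable Gamma (Tensor a (Neg a)).
Proof.
apply: (@derivable_raa _ _ (CTensor a (CNeg a))).
apply: (@NegE _ _ (CTensor a (CNeg a))); last exact: assumeU1.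
apply: TensorC; apply: TensorI; apply: NegI.
apply: (@NegE _ _ (CTensor a (CNeg a))); last exact/weakenU1/assumeU1.
exact/TensorI/assumeU1.
Qed.

Lemma derivable_nni (P : Type) (Gamma : set (form P)) (a : cform P) :
  derivable Gamma a -> derivable Gamma (Neg (CNeg a)).
Proof.
move=> d; apply: NegI; apply: (@NegE _ _ a); first exact: weakenU1.
exact: assumeU1.
Qed.

Lemma tensor_mono (P : Type) (Gamma : set (form P)) (phi phi' psi psi' : form P) :
  derivable (phi |` Gamma) phi' -> derivable (psi |` Gamma) psi' ->
  derivable Gamma (Tensor phi psi) -> derivable Gamma (Tensor phi' psi').
Proof.
move=> d1 d2 d; apply: TensorC; apply: TensorSub d1; apply: TensorC.
exact: TensorSub d d2.
Qed.

(** Extends [BoxMon] to a possibly infinite [Delta], as the canonical model requires. *)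
Lemma box_mono (P : Type) (Gamma Delta : set (form P)) (psi : form P) :
  (forall phi, Delta phi -> derivable Gamma (Box phi)) -> derivable Delta psi ->
  derivable Gamma (Box psi).
Proof.
move=> GD /derivable_finite [l Dl d].
by apply: BoxMon d => phi /Dl; apply: GD.
Qed.

(** Contexts are positive, since no hole lies under a negation. The premise has no side assumptions
    because the modal rules admit none. *)
Lemma plug_mono (P : Type) (C : ctx P) (phi psi : form P) :
  derivable [set phi] psi -> derivable [set plug C phi] (plug C psi).
Proof.
move=> d.
have up (chi chi' : form P) U : derivable [set chi] chi' ->
    derivable (chi |` U) chi'.
  by apply: derivable_sub; apply: subsetUl.
elim: C => [|C IH chi|chi C IH|C IH chi|chi C IH|C IH|C IH] //=.
- apply: AndI; last by apply: (@AndE2 _ _ (plug C phi)); apply: Assume.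
  apply: derivable1_trans IH; apply: AndE1; exact: Assume.
- apply: AndI; first by apply: (@AndE1 _ _ _ (plug C phi)); apply: Assume.
  apply: derivable1_trans IH; apply: AndE2; exact: Assume.
- by apply: tensor_mono (up _ _ _ IH) (assumeU1 _ _) _; apply: Assume.
- by apply: tensor_mono (assumeU1 _ _) (up _ _ _ IH) _; apply: Assume.
- by apply: box_mono IH => _ ->; apply: Assume.
- by apply: DiaMon IH; apply: Assume.
Qed.

(** * Realizations *)

(* The splitting on the truth value of each [a] in [s] enumerates, one
   component at a time, all functions from truth values of [s] to truth values
   of [b]. *)
Fixpoint dep_realization (P : Type) (s : seq (cform P)) (b : cform P) :
    set (cform P) :=
  if s is a :: s' then
    [set r | exists r1 r2, [/\ dep_realization s' b r1, dep_realization s' b r2 &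
      r = CTensor (CAnd a r1) (CAnd (CNeg a) r2)]]
  else [set r | r = b \/ r = CNeg b].

Fixpoint realization (P : Type) (phi : form P) : set (cform P) :=
  match phi with
  | Var p => [set CVar p]
  | Bot => [set CBot]
  | Neg a => [set CNeg a]
  | Dep s b => dep_realization s b
  | And phi psi => [set r | exists r1 r2,
      [/\ realization phi r1, realization psi r2 & r = CAnd r1 r2]]
  | Tensor phi psi => [set r | exists r1 r2,
      [/\ realization phi r1, realization psi r2 & r = CTensor r1 r2]]
  | Box phi => [set r | exists2 r1, realization phi r1 & r = CBox r1]
  | Dia phi => [set r | exists2 r1, realization phi r1 & r = CDia r1]
  end.

Lemma sat_realization (P : Type) (M : model P) (phi : form P)
    (X : set (world M)) :
  sat phi X -> exists2 r, realization phi r & csat r X.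
Proof.
elim: phi X => [p||a|s b|phi IHphi psi IHpsi|phi IHphi psi IHpsi|phi IH|phi IH] X.
- by exists (CVar p).
- by exists CBot.
- by exists (CNeg a).
- rewrite [realization _]/=; elim: s X => [|a s IH] X.
    move=> /(@sat_plug_dep _ _ Hole) /= [bX|nbX].
      by exists b; [left|rewrite -sat_emb].
    by exists (CNeg b); [right|].
  (* On each of [X] inside [Y] and [X] outside [Y], the truth value of [a] is constant, so there [b]
     already depends on [s] alone. *)
  move=> dX; pose Y := [set w : world M | csat a [set w]].
  have [|r1 R1 s1] := IH (X `&` Y).
    move=> w u [Xw aw] [Xu au] wu; apply: dX => // c [<-|/wu//]; split=> //.
  have [|r2 R2 s2] := IH (X `&` ~` Y).
    move=> w u [Xw aw] [Xu au] wu; apply: dX => // c [<-|/wu//]; split=> //.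
  exists (CTensor (CAnd a r1) (CAnd (CNeg a) r2)); first by exists r1, r2.
  exists (X `&` Y), (X `&` ~` Y); split.
  + by rewrite -setIUr setUv setIT.
  + by split=> //; apply/csat_flat => w [].
  + by split=> // w [].
- move=> [/IHphi [r1 R1 s1] /IHpsi [r2 R2 s2]].
  by exists (CAnd r1 r2) => //; exists r1, r2.
- move=> [Y [Z [eX /IHphi [r1 R1 s1] /IHpsi [r2 R2 s2]]]].
  by exists (CTensor r1 r2); [exists r1, r2|exists Y, Z].
- by move=> /IH [r R s]; exists (CBox r) => //; exists r.
- by move=> [Y XY /IH [r R s]]; exists (CDia r); [exists r|exists Y].
Qed.

(** After [DepI], constancy of [a] allows a case distinction on [a]. In each case one side of the
    tensor is absurd, so [r1] or [r2] follows and the induction hypothesis applies. *)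
Lemma dep_realization_derivable (P : Type) (s : seq (cform P)) (b r : cform P) :
  dep_realization s b r -> derivable [set emb r] (Dep s b).
Proof.
elim: s r => [|a s IH] r.
  by case=> ->; [apply: DepI0|apply: DepI0N]; apply: Assume.
move=> [r1 [r2 [/IH d1 /IH d2 ->]]]; apply: DepI.
set D := [set phi | exists2 a, _ & _]; set Gamma := _ `|` _.
have hyp c : List.In c (a :: s) -> derivable Gamma (Dep [::] c).
  by move=> sc; apply: Assume; left; exists c.
have hT : derivable Gamma (Tensor (And a r1) (And (Neg a) r2)).
  by apply: Assume; right.
have absurd (U : set (form P)) (c : cform P) : derivable U a ->
    derivable U (Neg a) -> derivable U c.
  by move=> da dna; apply: BotE; apply: NegE da dna.
have concl (U : set (form P)) (c : cform P) : Gamma `<=` U ->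
    derivable U c -> derivable [set emb c] (Dep s b) -> derivable U (Dep [::] b).
  move=> sU dc /(derivable1_trans dc) dd; apply: DepE dd _ => e se.
  by apply: derivable_sub sU _; apply: hyp; right.
apply: (DepE0 (a := a)); first by apply: hyp; left.
- apply: concl d1; first exact: subsetUr.
  apply: (TensorE (phi := And a r1) (psi := And (Neg a) r2)).
  + exact: weakenU1.
  + by apply: AndE2; apply: assumeU1.
  + apply: absurd; first exact/weakenU1/assumeU1.
    by apply: AndE1; apply: assumeU1.
- apply: concl d2; first exact: subsetUr.
  apply: (TensorE (phi := And a r1) (psi := And (Neg a) r2)).
  + exact: weakenU1.
  + apply: absurd; last exact/weakenU1/assumeU1.
    by apply: AndE1; apply: assumeU1.
  + by apply: AndE2; apply: assumeU1.
Qed.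

Lemma realization_derivable (P : Type) (phi : form P) (r : cform P) :
  realization phi r -> derivable [set emb r] phi.
Proof.
elim: phi r => [p||a|s b|phi IHphi psi IHpsi|phi IHphi psi IHpsi|phi IH|phi IH] r /=.
- by move=> ->; apply: Assume.
- by move=> ->; apply: Assume.
- by move=> ->; apply: Assume.
- exact: dep_realization_derivable.
- move=> [r1 [r2 [/IHphi d1 /IHpsi d2 ->]]] /=.
  apply: AndI; [apply: derivable1_trans d1|apply: derivable1_trans d2].
    by apply: AndE1; apply: Assume.
  by apply: AndE2; apply: Assume.
- move=> [r1 [r2 [/IHphi d1 /IHpsi d2 ->]]] /=.
  apply: (derivable1_trans (phi := Tensor phi r2)).
    exact: (plug_mono (TensorL Hole r2) d1).
  exact: (plug_mono (TensorR phi Hole) d2).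
- by move=> [r1 /IH d ->]; apply: (plug_mono (BoxC Hole) d).
- by move=> [r1 /IH d ->]; apply: (plug_mono (DiaC Hole) d).
Qed.

Fixpoint ctx_comp (P : Type) (C D : ctx P) : ctx P :=
  match C with
  | Hole => D
  | AndL C phi => AndL (ctx_comp C D) phi
  | AndR phi C => AndR phi (ctx_comp C D)
  | TensorL C phi => TensorL (ctx_comp C D) phi
  | TensorR phi C => TensorR phi (ctx_comp C D)
  | BoxC C => BoxC (ctx_comp C D)
  | DiaC C => DiaC (ctx_comp C D)
  end.

Lemma plug_comp (P : Type) (C D : ctx P) (phi : form P) :
  plug (ctx_comp C D) phi = plug C (plug D phi).
Proof.
by elim: C => [|C IH chi|chi C IH|C IH chi|chi C IH|C IH|C IH] //=; rewrite IH.
Qed.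

Lemma dep_cons_derivable (P : Type) (a b : cform P) (s : seq (cform P)) :
  derivable [set Dep (a :: s) b]
    (Tensor (And a (Dep s b)) (And (Neg a) (Dep s b))).
Proof.
have dep (U : set (form P)) : derivable U (Dep [::] a) ->
    U (Dep (a :: s) b) -> derivable U (Dep s b).
  move=> da Ud; apply: DepI; apply: (DepE (s := a :: s)).
    by apply: Assume; right.
  move=> c [<-|sc]; first by apply: derivable_sub da; apply: subsetUr.
  by apply: Assume; left; exists c.
apply: tensor_mono (derivable_em _ a).
- apply: AndI; first exact: assumeU1.
  by apply: dep; [apply/DepI0/assumeU1|right].
- apply: AndI; first exact: assumeU1.
  by apply: dep; [apply/DepI0N/assumeU1|right].
Qed.

(* This simulates elimination of the (inexpressible) global disjunction of all
   realizations of [phi]; the context is what makes the induction on [phi]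
   possible. *)
Lemma realization_elim (P : Type) (phi : form P) (C : ctx P)
    (Gamma : set (form P)) (theta : form P) :
  (forall r, realization phi r -> derivable (plug C (emb r) |` Gamma) theta) ->
  derivable (plug C phi |` Gamma) theta.
Proof.
(* [E] surrounds [psi] within the current connective and [D] is the outer context; the induction
   hypothesis is used in their composition. *)
have step (D E : ctx P) (psi : form P) (R : set (cform P)) Delta :
    (forall C', (forall r, R r -> derivable (plug C' (emb r) |` Delta) theta) ->
      derivable (plug C' psi |` Delta) theta) ->
    (forall r, R r -> derivable (plug D (plug E (emb r)) |` Delta) theta) ->
    derivable (plug D (plug E psi) |` Delta) theta.
  move=> IH h; rewrite -plug_comp; apply: IH => r Rr.
  by rewrite plug_comp; apply: h.
elim: phi C => [p||a|s b|phi IHphi psi IHpsi|phi IHphi psi IHpsi|phi IH|phi IH] C.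
- by move/(_ (CVar p) erefl).
- by move/(_ CBot erefl).
- by move/(_ (CNeg a) erefl).
- rewrite [realization _]/=; elim: s C => [|a s IH] C h.
    (* With no components left, the claim is the rule [SE] itself. *)
    apply: SE (assumeU1 _ _) _ _.
      by apply: derivable_sub (h b _); [apply: setUS; apply: subsetUr|left].
    by apply: derivable_sub (h (CNeg b) _); [apply: setUS; apply: subsetUr|right].
  apply: (@derivable_trans _ _
    (plug C (Tensor (And a (Dep s b)) (And (Neg a) (Dep s b))))).
    apply: derivable_sub (plug_mono C (dep_cons_derivable a b s)).
    exact: subsetUl.
  suff d : derivable
      (plug C (Tensor (And a (Dep s b)) (And (Neg a) (Dep s b))) |` Gamma) theta.
    by apply: derivable_sub d; apply: setUS; apply: subsetUr.
  (* The two copies of [Dep s b] are realized one after the other, independently, as [r1] and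
     [r2]. *)
  apply: (step C (TensorL (AndR a Hole) (And (Neg a) (Dep s b))) _ _ _ IH).
  move=> r1 R1.
  apply: (step C (TensorR (And a r1) (AndR (Neg a) Hole)) _ _ _ IH) => r2 R2.
  by apply: (h (CTensor (CAnd a r1) (CAnd (CNeg a) r2))); exists r1, r2.
- move=> h; apply: (step C (AndL Hole psi) _ _ _ IHphi) => r1 R1.
  apply: (step C (AndR r1 Hole) _ _ _ IHpsi) => r2 R2.
  by apply: (h (CAnd r1 r2)); exists r1, r2.
- move=> h; apply: (step C (TensorL Hole psi) _ _ _ IHphi) => r1 R1.
  apply: (step C (TensorR r1 Hole) _ _ _ IHpsi) => r2 R2.
  by apply: (h (CTensor r1 r2)); exists r1, r2.
- move=> h; apply: (step C (BoxC Hole) _ _ _ IH) => r R.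
  by apply: (h (CBox r)); exists r.
- move=> h; apply: (step C (DiaC Hole) _ _ _ IH) => r R.
  by apply: (h (CDia r)); exists r.
Qed.

(** * Canonical model *)

(** For [theta] equal to [Bot] these are the maximal consistent sets. A general [theta] is allowed
    because a nonclassical formula cannot be refuted by adding its negation. *)
Definition maximal_avoiding (P : Type) (theta : form P) (Delta : set (form P)) :=
  ~ derivable Delta theta /\
  forall psi, ~ Delta psi -> derivable (psi |` Delta) theta.

Lemma lindenbaum (P : Type) (theta : form P) (Gamma : set (form P)) :
  ~ derivable Gamma theta ->
  exists2 Delta, Gamma `<=` Delta & maximal_avoiding theta Delta.
Proof.
move=> nG.
have [F sF totF|A [nA maxA]] :=
    (* Zorn's lemma ranges over the sets added to [Gamma], so that the empty chain, with empty
       union, needs only the hypothesis on [Gamma]. *)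
    @Zorn_bigcup _ [set D | ~ derivable (Gamma `|` D) theta].
  move=> /derivable_finite [l Gl d].
  have [l' Fl' sl'] := finite_split Gl.
  (* Finitely many formulas from the union of a chain lie in a single member, unless there are
     none. *)
  have [[D FD lD]|l0] : (exists2 D, F D & [set y | List.In y l'] `<=` D) \/
      l' = [::].
    elim: l' Fl' {sl'} => [|x l' IH] Fl'; first by right.
    have [D FD Dx] := Fl' x (or_introl erefl).
    left; have [|[E FE lE]|l0] := IH; first by move=> y ly; apply: Fl'; right.
      have [sDE|sED] := totF D E FD FE.
        by exists E => // y [<-|/lE//]; apply: sDE.
      by exists D => // y [<-//|/lE]; apply: sED.
    by exists D => // y; rewrite l0 => -[<-|].
  - apply: (sF D FD); apply: derivable_sub d => y /sl' [Gy|/lD Dy].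
      by left.
    by right.
  - by apply: nG; apply: derivable_sub d => y /sl' [//|]; rewrite l0.
exists (Gamma `|` A); first exact: subsetUl.
split=> // psi nGA; apply: contrapT => npsi.
apply: (maxA (psi |` A)); last by rewrite /= setUCA.
split; first exact: subsetUr.
by move=> /(_ psi (or_introl erefl)) Apsi; apply: nGA; right.
Qed.

Lemma maximal_closed (P : Type) (theta phi : form P) (Delta : set (form P)) :
  maximal_avoiding theta Delta -> derivable Delta phi -> Delta phi.
Proof.
move=> [nD maxD] d; apply: contrapT => /maxD.
by move=> /(derivable_trans d).
Qed.

Definition canonical_world (P : Type) := {w : set (form P) | maximal_avoiding Bot w}.

Definition canonical_acc (P : Type) (w v : canonical_world P) :=
  forall phi, sval w (Box phi) -> sval v phi.

Lemma canonical_inhabited (P : Type) : inhabited (canonical_world P).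
Proof.
have [|w _ maxw] := @lindenbaum P Bot set0; last by exists; exists w.
(* Consistency of the system: by soundness, a derivation of [Bot] would make the full team of this
   one-point model empty. *)
pose M := @Model P unit (inhabits tt) (fun _ _ => True) (fun _ => set0).
move=> /soundness /(_ M setT) /= h.
have /seteqP [/(_ tt I)] : [set: unit] = set0 by apply: h.
by [].
Qed.

Definition canonical_model (P : Type) : model P :=
  Model (canonical_inhabited P) (@canonical_acc P)
    (fun p w => sval w (Var p)).

Lemma world_closed (P : Type) (w : canonical_world P) (phi : form P) :
  derivable (sval w) phi -> sval w phi.
Proof. exact: maximal_closed (svalP w). Qed.

Lemma world_neg (P : Type) (w : canonical_world P) (a : cform P) :
  sval w (Neg a) <-> ~ sval w a.
Proof.
have [nw maxw] := svalP w; split=> [na wa|/maxw d].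
  by apply: nw; apply: NegE (Assume wa) (Assume na).
exact/world_closed/NegI.
Qed.

(** If the boxed formulas of [w], stripped of their boxes, did not derive [a], then adding [Neg a]
    would be consistent, giving an accessible world without [a]. *)
Lemma world_box (P : Type) (w : canonical_world P) (a : cform P) :
  sval w (Box a) <-> forall v, canonical_acc w v -> sval v a.
Proof.
split=> [wa v|h]; first exact.
apply/world_closed/(box_mono (Delta := [set phi | sval w (Box phi)])).
  by move=> phi wphi; apply: Assume.
apply: derivable_raa; apply: contrapT => /lindenbaum [D sD maxD].
pose v : canonical_world P := exist _ D maxD.
have /world_neg : sval v (Neg a) by apply: sD; left.
by apply; apply: h => phi wphi; apply: sD; right.
Qed.

(** The duality that reduces [world_dia] to [world_box], obtained from the primitive rules
    exchanging a negated box with a diamond of a negation. *)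
Lemma derivable_box_neg (P : Type) (Gamma : set (form P)) (a : cform P) :
  derivable Gamma (Neg (CDia a)) <-> derivable Gamma (Box (Neg a)).
Proof.
split=> d.
- apply: (@derivable_raa _ _ (CBox (CNeg a))).
  apply: (@NegE _ _ (CDia a)); last exact: weakenU1.
  apply: (@DiaMon _ _ (Neg (CNeg a))); last by apply: NegNegE; apply: Assume.
  by apply: (@NegBoxE _ _ (CNeg a)); apply: assumeU1.
- apply: NegI; apply: (@NegE _ _ (CBox (CNeg a))); first exact: weakenU1.
  apply: (@NegBoxI _ _ (CNeg a)); apply: (@DiaMon _ _ a); first exact: assumeU1.
  by apply: derivable_nni; apply: Assume.
Qed.

Lemma world_dia (P : Type) (w : canonical_world P) (a : cform P) :
  sval w (Dia a) <-> exists2 v, canonical_acc w v & sval v a.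
Proof.
have -> : sval w (Dia a) <-> ~ sval w (Box (Neg a)).
  have -> : sval w (Box (Neg a)) <-> sval w (Neg (CDia a)).
    by split=> /Assume/derivable_box_neg/world_closed.
  by rewrite (world_neg w (CDia a)) notK.
rewrite (world_box w (CNeg a)); split.
  apply: contra_notP => h v wv; apply/world_neg => va; apply: h.
  by exists v.
by move=> [v wv va] /(_ v wv) /world_neg.
Qed.

(** Singletons and classical formulas suffice: flatness passes to larger teams, and realizations to
    all formulas. *)
Lemma truth_lemma (P : Type) (a : cform P) (w : canonical_world P) :
  csat (M := canonical_model P) a [set w] <-> sval w a.
Proof.
have [nw _] := svalP w.
elim: a w nw => [p||a IH|a IHa b IHb|a IHa b IHb|a IH|a IH] w nw.
- by split=> [/(_ w erefl)|wp _ ->].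
- split=> [/seteqP [/(_ w erefl)]//|/= wB].
  by case: nw; apply: Assume.
- by rewrite csat_neg (world_neg w a) IH.
- rewrite [csat _ _]/= IHa // IHb //; split.
    by move=> [wa wb]; apply/world_closed/AndI; apply: Assume.
  move=> /= /Assume d; split; apply: world_closed.
    exact: AndE1 d.
  exact: AndE2 d.
- rewrite csat_tensor IHa // IHb //; split.
    move=> [wa|wb]; apply: world_closed; first exact/TensorI/Assume.
    exact/TensorC/TensorI/Assume.
  move=> /= wab; apply: contrapT => /not_orP [/world_neg na /world_neg nb].
  apply: nw; apply: (@TensorE _ _ a b CBot); first exact: Assume.
    by apply: NegE (assumeU1 _ _) _; apply/weakenU1/Assume.
  by apply: NegE (assumeU1 _ _) _; apply/weakenU1/Assume.
- rewrite csat_box [emb _]/= world_box.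
  by split=> h v /h; rewrite IH //; case: (svalP v).
- rewrite csat_dia [emb _]/= world_dia.
  by split=> -[v wv hv]; exists v => //; move: hv; rewrite IH //;
    case: (svalP v).
Qed.

(** * Soundness and strong completeness *)

Theorem corollary2p22 (P : Type) (Gamma : set (form P)) (phi : form P) :
  entails Gamma phi <-> derivable Gamma phi.
Proof.
split; last exact: soundness.
move=> ent; apply: contrapT => /lindenbaum [Delta sGD maxD].
have [nD _] := maxD.
pose X : set (world (canonical_model P)) := [set w | Delta `<=` sval w].
have satX : forall gamma, Gamma gamma -> sat gamma X.
  move=> gamma /sGD Dg.
  have [[r [Rr Dr]]|nr] := pselect (exists r, realization gamma r /\ Delta (emb r)).
    apply: (soundness (realization_derivable Rr)) => _ ->.
    by rewrite sat_emb; apply/csat_flat => w Xw; apply/truth_lemma/Xw.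
  (* If [Delta] contained no realization of [gamma], then by maximality each one, added to [Delta],
     would derive [phi]; hence so would [gamma], which is in [Delta]. *)
  case: nD; apply: derivable_trans (Assume Dg) _.
  apply: (@realization_elim _ gamma Hole) => r Rr; apply: maxD.2 => Dr.
  by apply: nr; exists r.
have [r Rr /csat_flat rX] := sat_realization (ent _ _ satX).
apply: nD; apply: derivable1_trans (realization_derivable Rr).
(* Otherwise [Delta] with [Neg r] is consistent and extends to a world of [X], where [r] would both
   hold and fail. *)
apply: derivable_raa; apply: contrapT => /lindenbaum [D sD maxD'].
pose w : canonical_world P := exist _ D maxD'.
have /world_neg : sval w (Neg r) by apply: sD; left.
by apply; apply/truth_lemma/rX => psi Dpsi; apply: sD; right.
Qed.
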